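(* Let $\mathbf p=(p^1,\dots,p^m)$ be fixed-horizon p-values for $m$ experiments whose data are independent across experiments, let $\alpha\in(0,1)$, let $S^{BH}$ be the rejection set of the BH-I procedure at level $\alpha$ applied to $\mathbf p$, let $R^{BH}=|S^{BH}|$, and let $(CI^i(1-s))_{i=1}^m$ be the corresponding fixed-horizon confidence intervals at each level $s\in(0,1)$. Define the corrected confidence intervals $$\tilde{CI}^i=\begin{cases}CI^i(1-R^{BH}\alpha/m)& i\in S^{BH},\\ CI^i(1-(R^{BH}+1)\alpha/m)& i\notin S^{BH}.\end{cases}$$ Then for any fixed $J\subset\{1,\dots,m\}$ with $j=|J|$, if the selection rule is to select the experiments $J\cup S^{BH}$, the false coverage rate of the intervals $(\tilde{CI}^i)$ is at most $\alpha(1+j/m)$.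
   Context: Experiment $i$ has true parameter $\theta^i$ and tests $H_0^i:\theta^i=\theta_0^i$ at a fixed sample size. For each $i$ and each candidate value $\vartheta$, $p^{i,\vartheta}$ is a $[0,1]$-valued function of the data of experiment $i$ that is super-uniform when $\theta^i=\vartheta$, i.e. $\mathbb P(p^{i,\vartheta}\le s)\le s$ for all $s\in[0,1]$; $p^i=p^{i,\theta^i_0}$, and the corresponding confidence intervals are $CI^i(1-s)=\{\vartheta:p^{i,\vartheta}>s\}$, so $\mathbb P(\theta^i\in CI^i(1-s))\ge1-s$. BH-I at level $\alpha$ (the version of Benjamini–Hochberg used under independence across experiments): with p-values ordered increasingly $p^{(1)}\le\dots\le p^{(m)}$, reject hypotheses $(1),\dots,(k)$ where $k$ is maximal with $p^{(k)}\le\alpha k/m$ (none if no such $k$). The false coverage rate (FCR) is the expected proportion, among the selected experiments, of those whose confidence interval fails to contain the true parameter, the proportion being set to $0$ if none are selected. *)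

(* Defs.v *)
(* MathComp-Analysis *)
From HB Require Import structures.
From mathcomp Require Import all_boot all_order all_algebra.
From mathcomp Require Import all_classical all_reals all_analysis.

Import Order.TTheory GRing.Theory Num.Theory.

Local Open Scope classical_set_scope.
Local Open Scope ring_scope.

Definition mutually_independent {R : realType} {d0 : measure_display}
    {Omega : measurableType d0} (P : probability Omega R) {m : nat}
    {d : 'I_m -> measure_display} {E : forall i : 'I_m, measurableType (d i)}
    (X : forall i : 'I_m, Omega -> E i) : Prop :=
  forall (I : {set 'I_m}) (A : forall i : 'I_m, set (E i)),
    (forall i, measurable (A i)) ->
    P (\bigcap_(i in [set` I]) (X i @^-1` A i)) =
    (\prod_(i in I) P (X i @^-1` A i))%E.

Definition super_uniform {R : realType} {d0 : measure_display}
    {Omega : measurableType d0} (P : probability Omega R) (q : Omega -> R)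
    : Prop :=
  forall s : R, 0 <= s <= 1 -> (P [set w | (q w <= s)%R] <= s%:E)%E.

(* The argument [c] is the nominal confidence level, so that [conf_int p x (1 - s)]
   is {v | p v x > s}. *)
Definition conf_int {R : realType} {Theta E : Type} (p : Theta -> E -> R)
    (x : E) (c : R) : set Theta :=
  [set v | 1 - c < p v x].

Section BenjaminiHochberg.
Context {R : realType} {m : nat} (alpha : R) (q : 'I_m -> R).

Definition bh_order : seq 'I_m :=
  sort (fun i j : 'I_m => q i <= q j) (enum 'I_m).

(* Positions are 0-based: [nth 0 _ k] is the (k+1)-st smallest p-value.
   The maximum over no positions is 0, i.e. nothing is rejected. *)
Definition bh_count : nat :=
  (\max_(k < m | (nth 0 (map q bh_order) k <= alpha * k.+1%:R / m%:R)%R) k.+1)%N.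

Definition bh_rejections : {set 'I_m} :=
  [set i in take bh_count bh_order]%SET.

End BenjaminiHochberg.

Definition false_coverage_prop {R : realType} {m : nat} {Theta : 'I_m -> Type}
    (theta : forall i : 'I_m, Theta i) (sel : {set 'I_m})
    (CI : forall i : 'I_m, set (Theta i)) : R :=
  if #|sel| == 0%N then 0
  else #|[set i in sel | theta i \notin CI i]%SET|%:R / #|sel|%:R.

Definition false_coverage_rate {R : realType} {d0 : measure_display}
    {Omega : measurableType d0} (P : probability Omega R) {m : nat}
    {Theta : 'I_m -> Type} (theta : forall i : 'I_m, Theta i)
    (sel : Omega -> {set 'I_m})
    (CI : Omega -> forall i : 'I_m, set (Theta i)) : \bar R :=
  ('E_P [fun w => false_coverage_prop theta (sel w) (CI w)])%E.

Definition corrected_conf_int {R : realType} {m : nat} (alpha : R)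
    {Theta E : 'I_m -> Type} (p : forall i : 'I_m, Theta i -> E i -> R)
    (x : forall i : 'I_m, E i) (S : {set 'I_m}) (i : 'I_m) : set (Theta i) :=
  if i \in S then conf_int (p i) (x i) (1 - #|S|%:R * alpha / m%:R)
  else conf_int (p i) (x i) (1 - (#|S|%:R + 1) * alpha / m%:R).

(* Main.v *)
(* Write R for the number of rejections. A p-value is recorded only through the
   set of thresholds alpha * k / m that it does not exceed; R is a function of
   these finitely many records. The false coverage proportion is at most the
   sum of two leave-one-out contributions per experiment i. If i is rejected,
   R does not change when its record is replaced by the full set of thresholds,
   and a miscovering interval contributes at most 1/R. If i lies in J but is
   not rejected, R does not change when its record is replaced by the empty
   set, and the contribution is at most 1/(R+1). In both cases the denominator
   n no longer depends on the data of experiment i, while miscoverage means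
   that the p-value at the true parameter is at most (alpha/m) * n; by
   independence and super-uniformity the expected contribution is at most
   alpha/m. There are m contributions of the first kind and |J| of the second. *)
Require Import Defs.
From HB Require Import structures.
From mathcomp Require Import all_boot all_order all_algebra.
From mathcomp Require Import all_classical all_reals all_analysis.
From mathcomp Require Import measurable_realfun.

Import Order.TTheory GRing.Theory Num.Theory.

Local Open Scope classical_set_scope.
Local Open Scope ring_scope.

(** * Step-up counts as functions of threshold records *)

(** [c i] plays the record of experiment [i]: the indices of the thresholds that its p-value
    meets. *)
Definition step_card {m : nat} (c : {ffun 'I_m -> {set 'I_m.+1}})
    (k : 'I_m.+1) : nat :=
  #|[set i | k \in c i]%SET|.

Definition step_count {m : nat} (c : {ffun 'I_m -> {set 'I_m.+1}}) : nat :=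
  (\max_(k < m.+1 | (k <= step_card c k)%N) k)%N.

Definition set_coord {m : nat} {T : Type} (c : {ffun 'I_m -> T}) (i : 'I_m)
    (t : T) : {ffun 'I_m -> T} :=
  [ffun k => if k == i then t else c k].

(** Index [0] always qualifies, so the maximum is attained. Invariance of the count then reduces to
    comparing [step_card] from [r] upwards. *)
Lemma step_countP {m : nat} (c : {ffun 'I_m -> {set 'I_m.+1}}) (r : 'I_m.+1) :
  step_count c = r <->
  (r <= step_card c r)%N /\
  (forall k : 'I_m.+1, (r < k)%N -> (step_card c k < k)%N).
Proof.
split=> [rE | [rr rmax]].
  have [|k kk kE] := @eq_bigmax_cond _
    [pred k : 'I_m.+1 | (k <= step_card c k)%N] (fun k => k : nat).
    by apply/card_gt0P; exists ord0; rewrite inE.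
  have <- : k = r by apply: val_inj; rewrite /= -rE -kE.
  split=> // l; apply: contraTltn => ll; rewrite -leqNgt -kE.
  exact: (@leq_bigmax_cond _ [pred k : 'I_m.+1 | (k <= step_card c k)%N]
    (fun k => k : nat)).
apply/eqP; rewrite eqn_leq; apply/andP; split; last exact: (bigop.bigmax_sup r).
by apply/bigmax_leqP => k; apply: contraTT; rewrite -!ltnNge => /rmax.
Qed.

Lemma step_count_ord {m : nat} (c : {ffun 'I_m -> {set 'I_m.+1}}) :
  exists r : 'I_m.+1, step_count c = r.
Proof.
have rlt : (step_count c < m.+1)%N.
  by rewrite ltnS; apply/bigmax_leqP => k _; rewrite -ltnS.
by exists (Ordinal rlt).
Qed.

(** Whether the count is [r] depends only on [step_card] at [r] and above, where filling the record
    of [i] adds nothing. *)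
Lemma step_count_set_coordT {m : nat} (c : {ffun 'I_m -> {set 'I_m.+1}})
    (r : 'I_m.+1) (i : 'I_m) :
  step_count c = r ->
  (forall k : 'I_m.+1, (r <= k)%N -> k \in c i) ->
  step_count (set_coord c i [set: 'I_m.+1]%SET) = r.
Proof.
move=> /step_countP[rr rmax] ci.
have cE (k : 'I_m.+1) : (r <= k)%N ->
    step_card (set_coord c i [set: 'I_m.+1]%SET) k = step_card c k.
  move=> rk; congr #|pred_of_set _|; apply/setP => l; rewrite !inE ffunE.
  by case: eqP => // ->; rewrite ci// inE.
apply/step_countP; split; first by rewrite cE.
by move=> k rk; rewrite cE ?rmax// ltnW.
Qed.

(** Emptying a record can only lower [step_card], so indices above [r] still fail; at [r] the record
    of [i] was not counted. *)
Lemma step_count_set_coord0 {m : nat} (c : {ffun 'I_m -> {set 'I_m.+1}})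
    (r : 'I_m.+1) (i : 'I_m) :
  step_count c = r -> r \notin c i ->
  step_count (set_coord c i finset.set0) = r.
Proof.
move=> /step_countP[rr rmax] ci; apply/step_countP; split.
  apply: (leq_trans rr); apply: subset_leq_card; apply/fintype.subsetP => l.
  by rewrite !inE ffunE; case: eqP => // ->; rewrite (negPf ci).
move=> k /rmax; apply: leq_ltn_trans; apply: subset_leq_card.
apply/fintype.subsetP => l.
by rewrite !inE ffunE; case: eqP => // _; rewrite inE.
Qed.

(** * The BH procedure as a step-up count *)

Definition bh_levels {R : realType} {m : nat} (alpha : R) (q : 'I_m -> R) :
    {ffun 'I_m -> {set 'I_m.+1}} :=
  [ffun i => [set t : 'I_m.+1 | q i <= alpha * t%:R / m%:R]%SET].

Lemma count_bh_order {R : realType} {m : nat} (q : 'I_m -> R) (x : R) :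
  count (<= x) (map q (bh_order q)) = #|[set i | q i <= x]%SET|.
Proof.
rewrite count_map (permP (permEl (perm_sort _ _))) cardsE cardE.
by rewrite -size_filter enumT.
Qed.

Lemma map_bh_order_sorted {R : realType} {m : nat} (q : 'I_m -> R) :
  sorted <=%O (map q (bh_order q)).
Proof.
rewrite sorted_map; apply: sort_sorted => i j; exact: le_total.
Qed.

Lemma nth_bh_order_le {R : realType} {m : nat} (q : 'I_m -> R) (x : R)
    (k : 'I_m) :
  (nth 0 (map q (bh_order q)) k <= x) = (k < #|[set i | (q i <= x)%R]%SET|)%N.
Proof.
rewrite -count_bh_order; apply/idP/idP; last first.
  exact: (nth_count_le _ (map_bh_order_sorted q)).
apply: contraTT; rewrite -leqNgt -ltNge => kx.
apply: (nth_count_gt _ (map_bh_order_sorted q)).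
by rewrite kx size_map size_sort size_enum_ord ltn_ord.
Qed.

Lemma step_card_bh_levels {R : realType} {m : nat} (alpha : R) (q : 'I_m -> R)
    (k : 'I_m.+1) :
  step_card (bh_levels alpha q) k =
  #|[set i | q i <= alpha * k%:R / m%:R]%SET|.
Proof.
by congr #|pred_of_set _|; apply/setP => i; rewrite !inE ffunE inE.
Qed.

Lemma bh_countE {R : realType} {m : nat} (alpha : R) (q : 'I_m -> R) :
  bh_count alpha q = step_count (bh_levels alpha q).
Proof.
(* Index [0] contributes [0]; the others shift by one to match 0-based positions. *)
rewrite /bh_count /step_count [RHS]big_mkcond big_ord_recl /= max0n.
rewrite -big_mkcond; apply: eq_bigl => k.
by rewrite nth_bh_order_le step_card_bh_levels.
Qed.

(* Maximality of the rejection count forces the number of p-values below the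
   rejection threshold to equal the count, so ties at the threshold are all
   rejected. *)
Lemma bh_rejectionsP {R : realType} {m : nat} (alpha : R) (q : 'I_m -> R)
    (r : 'I_m.+1) :
  0 <= alpha -> step_count (bh_levels alpha q) = r ->
  (bh_rejections alpha q = [set i | q i <= alpha * r%:R / m%:R]%SET) /\
  (#|bh_rejections alpha q| = r).
Proof.
move=> a0 rE; have /step_countP[rr rmax] := rE.
have rcard : #|[set i | q i <= alpha * r%:R / m%:R]%SET| = r.
  rewrite -step_card_bh_levels; apply/eqP; rewrite eqn_leq rr andbT.
  (* If [s > r] p-values met the threshold at [r], they would meet the one at [s], and [s] would
     qualify too. *)
  have [s sE] : exists s : 'I_m.+1, s = step_card (bh_levels alpha q) r :> nat.
    have nlt : (step_card (bh_levels alpha q) r < m.+1)%N.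
      by rewrite ltnS -[m in (_ <= m)%N]card_ord max_card.
    by exists (Ordinal nlt).
  rewrite leqNgt -sE; apply/negP => rs; have := rmax s rs.
  rewrite ltnNge sE !step_card_bh_levels => /negP; apply.
  apply: subset_leq_card; apply/fintype.subsetP => i; rewrite !inE => /le_trans.
  by apply; rewrite ler_wpM2r ?invr_ge0// ler_wpM2l// ler_nat ltnW.
have SE : bh_rejections alpha q = [set i | q i <= alpha * r%:R / m%:R]%SET.
  apply/setP => i; rewrite !inE bh_countE rE.
  have iin : i \in bh_order q by rewrite mem_sort mem_enum.
  have szE : size (bh_order q) = m by rewrite size_sort size_enum_ord.
  have ilt : (index i (bh_order q) < m)%N.
    by rewrite -[X in (_ < X)%N]szE index_mem.
  (* Reading [r] as a number of p-values turns [index i < r] into a condition on [q i]. *)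
  rewrite in_take//; rewrite -[in LHS]rcard.
  rewrite -(nth_bh_order_le q _ (Ordinal ilt)) /=.
  by rewrite (nth_map i) ?szE// nth_index.
by split; rewrite SE.
Qed.

(* The value at [n = 0] is [0]. *)
Definition gated_inv {R : realFieldType} (a y : R) (n : nat) : R :=
  if y <= a * n%:R then n%:R^-1 else 0.

Lemma gated_inv_ge0 {R : realFieldType} (a y : R) (n : nat) :
  0 <= gated_inv a y n.
Proof. by rewrite /gated_inv; case: ifP => // _; rewrite invr_ge0. Qed.

(** * Leave-one-out expectations under independence *)

Section LeaveOneOut.
Context {R : realType} {d0 : measure_display} {Omega : measurableType d0}
  {P : probability Omega R} {m : nat} {d : 'I_m -> measure_display}
  {E : forall i : 'I_m, measurableType (d i)}
  {X : forall i : 'I_m, Omega -> E i} {T : finType}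
  {Y : forall i : 'I_m, E i -> T}.
Context (X_meas : forall i, measurable_fun setT (X i)).
Context (X_indep : mutually_independent P X).
Context (Y_meas : forall i t, measurable (Y i @^-1` [set t])).

Let profile (w : Omega) : {ffun 'I_m -> T} := [ffun k => Y k (X k w)].

Let others (i : 'I_m) (c : {ffun 'I_m -> T}) : set Omega :=
  \bigcap_(k in [set` [set~ i]%SET]) (X k @^-1` (Y k @^-1` [set c k])).

(** [others i c] ignores [c i], so pinning that coordinate to [t] lists each configuration of the
    other experiments once. *)
Let profiles_at (i : 'I_m) (t : T) : seq {ffun 'I_m -> T} :=
  [seq c : {ffun _ -> _} <- enum {: {ffun 'I_m -> T}} | c i == t].

Let measurable_others i c : measurable (others i c).
Proof.
apply: fin_bigcap_measurable => [|k _]; first exact: finite_finset.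
by rewrite -[X in measurable X]setTI; exact: X_meas.
Qed.

(** The events [others i c] partition the space: only the term of the observed configuration
    survives. *)
Let sum_others (i : 'I_m) (t : T) (F : {ffun 'I_m -> T} -> R) (w : Omega) :
  \sum_(c <- profiles_at i t) F c * \1_(others i c) w =
  F (set_coord (profile w) i t).
Proof.
set cw := set_coord _ _ _.
have memE (c : {ffun 'I_m -> T}) : c i == t -> (w \in others i c) = (c == cw).
  move=> /eqP cit; apply/idP/eqP => [|->]; rewrite inE.
    move=> cY; apply/ffunP => k; rewrite !ffunE; case: eqP => [->//|/eqP ki].
    by have /= -> := cY k; rewrite //= !inE.
  by move=> k /=; rewrite !inE !ffunE => /negPf ->.
rewrite big_filter big_enum_cond /= (bigD1 cw) /=; last by rewrite ffunE eqxx.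
rewrite indicE memE ?eqxx ?mulr1; last by rewrite ffunE eqxx.
rewrite big1 ?addr0// => c /andP[ci /negPf cE].
by rewrite indicE memE// cE mulr0.
Qed.

Let indep_others (i : 'I_m) (c : {ffun 'I_m -> T}) (A : set (E i)) :
  measurable A ->
  P (X i @^-1` A `&` others i c) = (P (X i @^-1` A) * P (others i c))%E.
Proof.
move=> mA.
(* With [A] in slot [i], both the joint event and [others i c] are intersections covered by
   [X_indep]. *)
pose B := dfwith (fun k => Y k @^-1` [set c k]) i A.
have mB k : measurable (B k).
  by rewrite /B; case: dfwithP => // *; exact: Y_meas.
have BE k : k != i -> B k = Y k @^-1` [set c k].
  by move=> ki; rewrite /B dfwithout// eq_sym.
have oE : others i c = \bigcap_(k in [set` [set~ i]%SET]) (X k @^-1` B k).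
  by apply: eq_bigcapr => k /=; rewrite !inE => ki; rewrite BE.
have -> : X i @^-1` A `&` others i c =
    \bigcap_(k in [set` [set: 'I_m]%SET]) (X k @^-1` B k).
  rewrite oE; apply/seteqP; split=> w /=.
    move=> [Aw ow] k _; have [->|ki] := eqVneq k i.
      by rewrite /B /= dfwithin.
    by apply: ow; rewrite /= !inE.
  move=> ow; split.
    by have := ow i; rewrite /B /= dfwithin; apply; rewrite inE.
  by move=> k _; apply: ow; rewrite /= inE.
rewrite X_indep// oE X_indep// (bigD1 i) ?inE//=.
rewrite [X in (P (_ @^-1` X) * _)%E]dfwithin; congr (_ * _)%E.
by apply: eq_bigl => k; rewrite !inE.
Qed.

(** The data of experiment [i] enters through the gate only: its coordinate in the argument of [g]
    is overwritten by [t]. *)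
Definition loo_ratio (a : R) (i : 'I_m) (q : E i -> R) (t : T)
    (g : {ffun 'I_m -> T} -> nat) (w : Omega) : R :=
  gated_inv a (q (X i w)) (g (set_coord [ffun k => Y k (X k w)] i t)).

Context (a : R) (i : 'I_m) (q : E i -> R) (t : T)
  (g : {ffun 'I_m -> T} -> nat).
Context (a0 : 0 <= a).
Context (q_meas : measurable_fun setT q).
Context (q_super : super_uniform P (fun w => q (X i w))).

Let below (c : {ffun 'I_m -> T}) : set (E i) :=
  [set x | q x <= a * (g c)%:R].

Let measurable_below c : measurable (below c).
Proof.
have -> : below c = setT `&` q @^-1` `]-oo, a * (g c)%:R].
  by rewrite setTI; apply/seteqP; split=> x /=; rewrite in_itv.
exact: q_meas.
Qed.

Let cell c : set Omega := X i @^-1` below c `&` others i c.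

Let measurable_cell c : measurable (cell c).
Proof.
apply: measurableI => //; rewrite -[X in measurable X]setTI.
exact: X_meas.
Qed.

Let loo_ratioE w : loo_ratio a i q t g w =
  \sum_(c <- profiles_at i t) (g c)%:R^-1 * \1_(cell c) w.
Proof.
pose F c : R := (g c)%:R^-1 * \1_(X i @^-1` below c) w.
rewrite -[LHS]/(if _ then _ else _).
transitivity (F (set_coord (profile w) i t)).
  rewrite /F indicE; case: ifPn => qw.
    by rewrite mem_set ?mulr1.
  by rewrite memNset ?mulr0//= /below /=; apply/negP.
rewrite -(sum_others i t F); apply: eq_bigr => c _.
by rewrite /F /cell indicI mulrA.
Qed.

Let measurable_cell_fun c :
  measurable_fun setT (fun w => (g c)%:R^-1 * \1_(cell c) w : R).
Proof. by apply: measurable_funM => //; exact: measurable_indic. Qed.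

Lemma loo_ratio_ge0 w : 0 <= loo_ratio a i q t g w.
Proof. exact: gated_inv_ge0. Qed.

Lemma measurable_loo_ratio : measurable_fun setT (loo_ratio a i q t g).
Proof.
rewrite (funext loo_ratioE); apply: measurable_sum => c.
exact: measurable_cell_fun.
Qed.

(** Super-uniformity covers levels up to [1]; beyond that the bound is trivial. *)
Lemma le_probability_below c : (P (X i @^-1` below c) <= (a * (g c)%:R)%:E)%E.
Proof.
have [le1|/ltW ge1] := leP (a * (g c)%:R) 1.
  by apply: q_super; rewrite le1 mulr_ge0.
apply: le_trans (probability_le1 _ _) _; rewrite ?lee_fin//.
by rewrite -[X in measurable X]setTI; exact: X_meas.
Qed.

Let sum_probability_others :
  (\sum_(c <- profiles_at i t) P (others i c) = 1)%E.
Proof.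
transitivity (\int[P]_w (\sum_(c <- profiles_at i t) (\1_(others i c) w)%:E))%E.
  rewrite ge0_integral_sum//.
    by apply: eq_bigr => c _; rewrite integral_indic// setIT.
  by move=> c; apply/measurable_EFinP; exact: measurable_indic.
transitivity (\int[P]_w (1%:E : \bar R))%E; last first.
  by rewrite integral_cst// mul1e; exact: probability_setT.
apply: eq_integral => w _; rewrite sumEFin; congr (_%:E).
rewrite -[RHS](sum_others i t (fun=> 1) w).
by apply: eq_bigr => c _; rewrite mul1r.
Qed.

(* Given the data of the other experiments the denominator is a constant [n],
   so the conditional expectation is at most [(a * n) / n]. *)
Lemma le_integral_loo_ratio :
  (\int[P]_w (loo_ratio a i q t g w)%:E <= a%:E)%E.
Proof.
under eq_integral do rewrite loo_ratioE -sumEFin.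
rewrite ge0_integral_sum//; first last.
  by move=> c; apply/measurable_EFinP; exact: measurable_cell_fun.
rewrite -[leRHS]mule1 -sum_probability_others ge0_sume_distrr//.
apply: lee_sum => c _.
under eq_integral do rewrite EFinM.
rewrite ge0_integralZl_EFin ?invr_ge0//; first last.
  by apply/measurable_EFinP; exact: measurable_indic.
rewrite integral_indic// setIT.
apply: (@le_trans _ _ ((g c)%:R^-1%:E *
  (P (X i @^-1` below c) * P (others i c)))%E).
  by rewrite -indep_others.
rewrite muleA lee_wpmul2r//.
(* At [g c = 0] the convention that [0] has inverse [0] kills the term. *)
have [g0|g_gt0] := posnP (g c); first by rewrite g0 invr0 mul0e lee_fin.
apply: (@le_trans _ _ ((g c)%:R^-1%:E * (a * (g c)%:R)%:E)%E).
  by rewrite lee_wpmul2l ?lee_fin ?invr_ge0// le_probability_below.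
by rewrite -EFinM lee_fin mulrCA mulVf ?mulr1// pnatr_eq0 -lt0n.
Qed.

End LeaveOneOut.

(** * Bounding the false coverage proportion *)

(** The integral of a nonnegative function is a supremum over simple functions below it. This lets
    the false coverage proportion be bounded without examining its measurability. *)
Lemma le_integral_nonmeasurable {d : measure_display} {T : measurableType d}
    {R : realType} (mu : {measure set T -> \bar R}) (f g : T -> \bar R) :
  (forall x, 0 <= f x)%E -> (forall x, f x <= g x)%E ->
  (\int[mu]_x f x <= \int[mu]_x g x)%E.
Proof.
move=> f0 fg; have g0 x : (0 <= g x)%E by exact: le_trans (fg x).
rewrite !ge0_integralTE//; apply: ereal_sup_le => _ [h hf <-].
by exists h => // x; exact: le_trans (hf x) (fg x).
Qed.

Lemma false_coverage_prop_le {R : realType} {m : nat} {Theta E : 'I_m -> Type}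
    (theta theta0 : forall i, Theta i) (p : forall i, Theta i -> E i -> R)
    (x : forall i, E i) (alpha : R) (J : {set 'I_m}) :
  0 <= alpha ->
  let c := bh_levels alpha (fun i => p i (theta0 i) (x i)) in
  let S := bh_rejections alpha (fun i => p i (theta0 i) (x i)) in
  false_coverage_prop theta (J :|: S) (corrected_conf_int alpha p x S) <=
    \sum_i gated_inv (alpha / m%:R) (p i (theta i) (x i))
      (step_count (set_coord c i [set: 'I_m.+1]%SET)) +
    \sum_(i in J) gated_inv (alpha / m%:R) (p i (theta i) (x i))
      (step_count (set_coord c i finset.set0)).+1.
Proof.
move=> a0; lazy zeta; set c := bh_levels _ _; set S := bh_rejections _ _.
rewrite /false_coverage_prop.
case: ifPn => [_|_].
  by rewrite addr_ge0// sumr_ge0// => *; exact: gated_inv_ge0.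
have [r rE] := step_count_ord c.
have [SE Scard] := bh_rejectionsP alpha _ r a0 rE.
rewrite -/S in SE Scard.
have inS i : (i \in S) = (r \in c i) by rewrite SE !inE ffunE inE.
(* Both sides become sums over all experiments, compared term by term. *)
rewrite -sum1_card natr_sum mulr_suml big_mkcond [X in _ + X]big_mkcond.
rewrite -big_split.
apply: ler_sum => i _; rewrite inE finset.in_setU mul1r.
have A0 := gated_inv_ge0 (alpha / m%:R) (p i (theta i) (x i))
  (step_count (set_coord c i [set: 'I_m.+1]%SET)).
have B0 := gated_inv_ge0 (alpha / m%:R) (p i (theta i) (x i))
  (step_count (set_coord c i finset.set0)).+1.
case: ifP => [/andP[sel]|_]; last by rewrite addr_ge0//; case: ifP.
rewrite notin_setE /corrected_conf_int; case: ifPn => iS.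
  rewrite /conf_int/= subKr Scard => /negP; rewrite -leNgt => bad.
  (* Thresholds grow with the index, so a record containing [r] contains all larger indices. *)
  have ci (k : 'I_m.+1) : (r <= k)%N -> k \in c i.
    move: iS; rewrite inS !ffunE !inE => + rk => /le_trans; apply.
    by rewrite ler_wpM2r ?invr_ge0// ler_wpM2l// ler_nat.
  rewrite (step_count_set_coordT c r i rE ci) {1}/gated_inv.
  rewrite (_ : _ / _ * _ = r%:R * alpha / m%:R) ?bad; last first.
    by rewrite mulrAC [alpha * _]mulrC.
  apply: ler_wpDr; first by case: ifP.
  have r0 : (0 < r)%N by rewrite -Scard; apply/card_gt0P; exists i.
  have rs : (r <= #|J :|: S|)%N.
    by rewrite -Scard subset_leq_card// finset.subsetUr.
  by rewrite lef_pV2 ?posrE ?ltr0n ?ler_nat// (leq_trans r0).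
rewrite /conf_int/= subKr Scard => /negP; rewrite -leNgt => bad.
have iJ : i \in J by move: sel; rewrite (negPf iS) orbF.
rewrite iJ (step_count_set_coord0 c r i rE) -?inS// {2}/gated_inv.
rewrite (_ : _ / _ * _ = (r%:R + 1) * alpha / m%:R) ?bad; last first.
  by rewrite mulrAC [alpha * _]mulrC natr1.
apply: ler_wpDl => //.
(* As [i] lies in [J] but outside [S], at least [r + 1] experiments are selected. *)
have rs : (r < #|J :|: S|)%N.
  rewrite -Scard; apply: proper_card; rewrite properE finset.subsetUr /=.
  by apply/fintype.subsetPn; exists i; rewrite // inE iJ.
by rewrite lef_pV2 ?posrE ?ltr0n ?ler_nat// (leq_ltn_trans _ rs).
Qed.

(** Equality when [m > 0]; for [m = 0] the left side is [0], since [alpha / 0 = 0]. *)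
Lemma mulrn_divr_le {R : realFieldType} (alpha : R) (m j : nat) :
  0 <= alpha ->
  (alpha / m%:R) *+ m + (alpha / m%:R) *+ j <= alpha * (1 + j%:R / m%:R).
Proof.
move=> a0; rewrite mulrDr mulr1; apply: lerD.
  rewrite -mulr_natr.
  have [->|m0] := eqVneq (m%:R : R) 0; first by rewrite mulr0.
  by rewrite divfK.
by rewrite -mulr_natr mulrAC mulrA.
Qed.

Theorem theorem4 (R : realType)
    (d0 : measure_display) (Omega : measurableType d0) (P : probability Omega R)
    (m : nat)
    (d : 'I_m -> measure_display) (E : forall i : 'I_m, measurableType (d i))
    (Theta : 'I_m -> Type)
    (theta theta0 : forall i : 'I_m, Theta i)
    (X : forall i : 'I_m, Omega -> E i)
    (p : forall i : 'I_m, Theta i -> E i -> R)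
    (alpha : R) (J : {set 'I_m})
    (X_meas : forall i, measurable_fun setT (X i))
    (X_indep : mutually_independent P X)
    (p_meas : forall i v, measurable_fun setT (p i v))
    (p_range : forall i v x, 0 <= p i v x <= 1)
    (p_super : forall i v, theta i = v ->
       super_uniform P (fun w => p i v (X i w)))
    (alpha01 : 0 < alpha < 1) :
  let SBH (w : Omega) : {set 'I_m} :=
    bh_rejections alpha (fun i => p i (theta0 i) (X i w)) in
  let CI (w : Omega) (i : 'I_m) : set (Theta i) :=
    corrected_conf_int alpha p (fun k => X k w) (SBH w) i in
  (false_coverage_rate P theta (fun w => J :|: SBH w) CI
     <= (alpha * (1 + #|J|%:R / m%:R))%:E)%E.
Proof.
lazy zeta.
have a0 : 0 <= alpha by case/andP: alpha01 => /ltW.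
pose c := alpha / m%:R.
have c0 : 0 <= c by rewrite divr_ge0.
pose Y i (x : E i) : {set 'I_m.+1} :=
  [set t : 'I_m.+1 | p i (theta0 i) x <= alpha * t%:R / m%:R]%SET.
have Y_meas i t : measurable (Y i @^-1` [set t]).
  have -> : Y i @^-1` [set t] = \bigcap_(k in [set: 'I_m.+1])
      [set x | (p i (theta0 i) x <= alpha * k%:R / m%:R) = (k \in t)].
    apply/seteqP; split=> x /= => [<- k _ /=|xY]; first by rewrite inE.
    by apply/setP => k; rewrite inE; exact: xY.
  apply: fin_bigcap_measurable => [|k _]; first exact: finite_finset.
  case: (k \in t).
    rewrite (_ : mkset _ = setT `&`
      p i (theta0 i) @^-1` `]-oo, alpha * k%:R / m%:R]); first exact: p_meas.
    by apply/seteqP; split=> x /=; rewrite in_itv/=; [move=> -> | case].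
  rewrite (_ : mkset _ = setT `&`
    p i (theta0 i) @^-1` `]alpha * k%:R / m%:R, +oo[); first exact: p_meas.
  apply/seteqP; split=> x /=; rewrite in_itv/= andbT ltNge; first by move=> ->.
  by case=> _ /negPf.
(* [U] serves rejected experiments, [V] those of [J] not rejected. The gate uses the true parameter,
   the records the tested one. *)
pose U i := @loo_ratio R d0 Omega m d E X _ Y c i (p i (theta i))
  [set: 'I_m.+1]%SET step_count.
pose V i := @loo_ratio R d0 Omega m d E X _ Y c i (p i (theta i))
  finset.set0 (fun l => (step_count l).+1).
have mU i : measurable_fun setT (EFin \o U i).
  by apply/measurable_EFinP; exact: measurable_loo_ratio.
have mV i : measurable_fun setT (EFin \o V i).
  by apply/measurable_EFinP; exact: measurable_loo_ratio.
have U0 i w : 0 <= U i w by exact: loo_ratio_ge0.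
have V0 i w : 0 <= V i w by exact: loo_ratio_ge0.
have IU i : (\int[P]_w (U i w)%:E <= c%:E)%E.
  by apply: le_integral_loo_ratio => //; exact: p_super.
have IV i : (\int[P]_w (V i w)%:E <= c%:E)%E.
  by apply: le_integral_loo_ratio => //; exact: p_super.
rewrite /false_coverage_rate unlock.
apply: (@le_trans _ _
    (\int[P]_w (\sum_i (U i w)%:E + \sum_(i <- enum J) (V i w)%:E))%E).
  apply: le_integral_nonmeasurable => w.
    rewrite lee_fin /false_coverage_prop.
    by case: ifP => // _; rewrite divr_ge0.
  rewrite !sumEFin -EFinD lee_fin [X in _ + X]big_enum.
  exact: false_coverage_prop_le.
rewrite ge0_integralD//; last first.
- by apply: emeasurable_sum => i; exact: mV.
- by move=> w _; apply: sume_ge0 => i _; rewrite lee_fin.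
- by apply: emeasurable_sum => i; exact: mU.
- by move=> w _; apply: sume_ge0 => i _; rewrite lee_fin.
rewrite !ge0_integral_sum//; first last.
- by move=> i w _; rewrite lee_fin.
- by move=> i w _; rewrite lee_fin.
apply: (@le_trans _ _ (\sum_(i < m) c%:E + \sum_(i <- enum J) c%:E)%E).
  by apply: leeD; apply: lee_sum => i _.
rewrite !sumEFin -EFinD lee_fin big_enum !sumr_const card_ord.
exact: mulrn_divr_le.
Qed.
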